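(* Let $K$ be a field of characteristic zero and let $A_1 = K\langle X, Y \mid YX - XY = 1\rangle$ be the first Weyl algebra over $K$. Let $P, Q \in A_1$ with $m(P) \leq 2$ and $m(Q) \leq 2$. If $PQ - QP = 1$, then there exists a $K$-algebra automorphism $\tau$ of $A_1$ such that $P = \tau(Y)$ and $Q = \tau(X)$.
   Context: The Weyl algebra $A_1$ is $\mathbb{Z}$-graded, $A_1 = \bigoplus_{i\in\mathbb{Z}} A_{1,i}$ with $A_{1,i}A_{1,j}\subseteq A_{1,i+j}$, where, writing $H = YX$, one has $A_{1,0} = K[H]$ and, for $i \geq 1$, $A_{1,i} = K[H]X^i$ and $A_{1,-i} = K[H]Y^i$. For a nonzero element $a \in A_1$, its mass $m(a)$ is the number of nonzero homogeneous components of $a$ with respect to this grading. *)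

(* Defs.v *)
(* Concrete model of the first Weyl algebra A_1 over a field K.

   An element of A_1 is represented in the PBW (normally ordered) basis
   X^i Y^j, i.e. as  a = \sum_j a_j(X) Y^j  with a_j in K[X].  We store it as
   a : {poly {poly K}}: the outer variable stands for Y, the inner one for X.
   (Equivalently: A_1 acting on K[t] with X = mult. by t, Y = d/dt.)
   The product is given by the Leibniz rule, which is forced by YX - XY = 1:
     (p Y^j) (q Y^k) = \sum_i C(j,i) p q^{(i)} Y^(j+k-i). *)
From HB Require Import structures.
From mathcomp Require Import all_boot all_order all_algebra.
Set Implicit Arguments. Unset Strict Implicit. Unset Printing Implicit Defensive.
Import Order.TTheory GRing.Theory Num.Theory.
Local Open Scope ring_scope.

Section Weyl.
Variable K : fieldType.

Definition weyl := {poly {poly K}}.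

Definition wX : weyl := ('X : {poly K})%:P.
Definition wY : weyl := 'X.
Definition w1 : weyl := 1.
Definition wK (c : K) : weyl := c%:P%:P.

Definition wmul (a b : weyl) : weyl :=
  \sum_(j < size a) \sum_(k < size b) \sum_(i < j.+1)
     (('C(j, i)%:R * (a`_j * (b`_k)^`(i)))%:P * 'X^(j + k - i)).

(* homogeneous component of degree d (X has degree 1, Y degree -1;
   the basis element X^i Y^j is homogeneous of degree i - j) *)
Definition wcomp (d : int) (a : weyl) : weyl :=
  \poly_(j < size a) \poly_(i < size a`_j)
     (if (i%:Z - j%:Z == d) then (a`_j)`_i else 0).

(* mass = number of nonzero homogeneous components; every degree i - j
   occurring lies in [-N, N] with N below. *)
Definition wbound (a : weyl) : nat :=
  addn (size a) (\big[addn/0%N]_(j < size a) size (a`_j)%R).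
Definition wmass (a : weyl) : nat :=
  let N := wbound a in
  count (fun d : int => wcomp d a != 0)
        [seq (k%:Z - N%:Z) | k <- iota 0 (addn N N).+1].

Definition weyl_aut (tau : weyl -> weyl) : Prop :=
  [/\ bijective tau,
      forall a b, tau (a + b) = tau a + tau b,
      forall c a, tau (wmul (wK c) a) = wmul (wK c) (tau a),
      forall a b, tau (wmul a b) = wmul (tau a) (tau b)
    & tau w1 = w1].

End Weyl.

(* Main.v *)
(* Each homogeneous component of degree d of an element of A_1 is encoded by its
   symbol, a polynomial p such that the component maps t^n to p(n) t^(n+d) in the
   natural action on K[t].  The commutator of two components of degrees i and j has
   symbol br i p j q = p(N+j) q - q(N+i) p, of degree at most deg p + deg q - 1,
   with equality as soon as j deg p <> i deg q.

   Let a, b and c, d be the degrees occurring in P and Q.  Some sum of degrees, say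
   a + c, vanishes.  If b + d <> 0, degree counting in [P_a, Q_c] = 1 makes
   {P_a, Q_c} scalar multiples of X and Y; the remaining components either commute
   with them, and are then powers of X or Y, or satisfy d = b - 2 (for a = 1), which
   the degrees exclude.  If also b + d = 0, then either one of the two
   degree-zero commutators vanishes, which leads to the same conclusion, or
   comparing degrees forces b = - a and Q_a, Q_-a to be proportional to P_a, P_-a,
   whence P and Q are linear in X and Y.  So (P, Q) is always obtained from (Y, X)
   by composing linear automorphisms and shears. *)
Require Import Defs.
From HB Require Import structures.
From mathcomp Require Import all_boot all_order all_algebra ring zify.
Import Order.TTheory GRing.Theory Num.Theory.
Set Implicit Arguments. Unset Strict Implicit. Unset Printing Implicit Defensive.
Local Open Scope ring_scope.

(** * The Weyl algebra as a K-algebra *)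

Section MulY.
Variable K : fieldType.

(* The operator [b |-> Y b], normally ordered. *)
Definition mulY (b : {poly {poly K}}) : {poly {poly K}} :=
  b * 'X + map_poly (@deriv K) b.

Lemma mulY0 : mulY 0 = 0.
Proof. by rewrite /mulY mul0r raddf0 addr0. Qed.

Lemma mulYD : {morph mulY : x y / x + y}.
Proof. by move=> x y; rewrite /mulY raddfD mulrDl addrACA. Qed.

HB.instance Definition _ :=
  GRing.isNmodMorphism.Build {poly {poly K}} {poly {poly K}} mulY (conj mulY0 mulYD).

Lemma mulYX b : mulY (b * 'X) = mulY b * 'X.
Proof.
rewrite /mulY mulrDl; congr (_ + _); apply/polyP => i.
by rewrite !(coef_map, coefMX) /=; case: i => //=; rewrite deriv0.
Qed.

Lemma mulYC f : mulY f%:P = f%:P * 'X + f^`()%:P.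
Proof. by rewrite /mulY map_polyC. Qed.

Lemma mulYZ f m : mulY (f *: m) = f^`() *: m + f *: mulY m.
Proof.
apply/polyP => i; rewrite /mulY !(coefD, coefZ, coefMX, coef_map) /= derivM.
by case: (i == 0)%N; rewrite ?mulr0 ?add0r // mulrDr addrCA.
Qed.

End MulY.
Arguments mulY {K} b.

(** * Modules over the Weyl algebra *)

Section Act.
Variables (K : fieldType) (M : lmodType {poly K}) (U : M -> M).
Hypothesis UD : {morph U : x y / x + y}.
Hypothesis UZ : forall f m, U (f *: m) = f^`() *: m + f *: U m.

(** A [{poly K}]-module with an additive operator [U] obeying the Leibniz rule is an $A_1$-module on
    which $Y$ acts as [U]. Taking [U] to be [mulY] gives the product of $A_1$; taking it to be
    differentiation gives the natural action on $K[t]$. *)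
Definition act (a : {poly {poly K}}) (m : M) : M :=
  \sum_(j < size a) a`_j *: iter j U m.

Lemma actE n (a : {poly {poly K}}) m :
  (size a <= n)%N -> act a m = \sum_(j < n) a`_j *: iter j U m.
Proof.
move=> le_an; rewrite /act (big_ord_widen n (fun j => a`_j *: iter j U m)) //.
rewrite big_mkcond; apply: eq_bigr => i _; case: ltnP => // le_i.
by rewrite nth_default // scale0r.
Qed.

Lemma actDl a b m : act (a + b) m = act a m + act b m.
Proof.
pose n := maxn (size a) (size b).
rewrite !(@actE n) ?leq_maxl ?leq_maxr ?size_polyD // -big_split.
by apply: eq_bigr => i _; rewrite coefD scalerDl.
Qed.

Lemma actZl f a m : act (f *: a) m = f *: act a m.
Proof.
rewrite (@actE (size a)) ?size_scale_leq // /act scaler_sumr.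
by apply: eq_bigr => i _; rewrite coefZ scalerA.
Qed.

Lemma actC f m : act f%:P m = f *: m.
Proof. by rewrite (@actE 1) ?size_polyC_leq1 // big_ord1 coefC. Qed.

Lemma actMX a m : act (a * 'X) m = act a (U m).
Proof.
have le_aX : (size (a * 'X)%R <= (size a).+1)%N.
  by rewrite (leq_trans (size_polyMleq _ _)) // size_polyX addn2.
rewrite (actE m le_aX) big_ord_recl coefMX scale0r add0r.
by apply: eq_bigr => i _; rewrite coefMX -iterSr.
Qed.

Lemma actDr a : {morph act a : x y / x + y}.
Proof.
move=> x y; rewrite /act -big_split; apply: eq_bigr => i _ /=.
suff -> : iter i U (x + y) = iter i U x + iter i U y by rewrite scalerDr.
by elim: (nat_of_ord i) => //= k ->.
Qed.

Lemma actZr (k : K) a m : act a (k%:P *: m) = k%:P *: act a m.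
Proof.
rewrite /act scaler_sumr; apply: eq_bigr => j _.
suff -> : iter j U (k%:P *: m) = k%:P *: iter j U m by rewrite !scalerA mulrC.
by elim: (nat_of_ord j) => //= i ->; rewrite UZ derivC scale0r add0r.
Qed.

(** Both sides behave alike when a right factor $Y$ is peeled off [b], so induction leaves only
    constants $f(X)$, where this is the Leibniz hypothesis [UZ]. *)
Lemma act_mulY b m : act (mulY b) m = U (act b m).
Proof.
elim/poly_ind: b m => [|b f IH] m.
  rewrite /mulY mul0r raddf0 addr0 /act size_poly0 !big_ord0.
  by have := UZ 0 0; rewrite deriv0 !scale0r addr0.
rewrite mulYD actDl [in RHS]actDl UD mulYX !actMX IH; congr (_ + _).
by rewrite mulYC actDl actMX !actC UZ addrC.
Qed.

Lemma iter_mulY j b m : act (iter j mulY b) m = iter j U (act b m).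
Proof. by elim: j b m => //= j IH b m; rewrite act_mulY IH. Qed.

End Act.

(** For the regular module this is associativity of the product; for $K[t]$ it says that the natural
    action is a representation. *)
Lemma act_act (K : fieldType) (M : lmodType {poly K}) (U : M -> M)
    (UD : {morph U : x y / x + y})
    (UZ : forall f m, U (f *: m) = f^`() *: m + f *: U m) a b m :
  act U (act (mulY) a b) m = act U a (act U b m).
Proof.
rewrite /(act _ a b) /(act U a _).
have act0 : act U 0 m = 0 by rewrite /act size_poly0 big_ord0.
rewrite (big_morph (fun x => act U x m) (fun x y => actDl U x y m) act0).
by apply: eq_bigr => i _; rewrite actZl iter_mulY.
Qed.

Lemma iter_mulYE (K : fieldType) j (b : {poly {poly K}}) :
  iter j (mulY) b =
  \sum_(i < j.+1) (map_poly (derivn i) b * 'X^(j - i)) *+ 'C(j, i).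
Proof.
elim: j => [|j IH].
  rewrite big_ord1 /= subnn expr0 mulr1 bin0 mulr1n.
  by apply/polyP => i; rewrite coef_map.
have mulY_mon i : mulY (map_poly (derivn i) b * 'X^(j - i)) =
    map_poly (derivn i) b * 'X^((j - i).+1) + map_poly (derivn i.+1) b * 'X^(j - i).
  rewrite /mulY -mulrA -exprSr; congr (_ + _); apply/polyP => k.
  rewrite coef_map !coefMXn; case: ifP => _ /=; rewrite ?deriv0 //.
  by rewrite !coef_map -derivnS.
rewrite iterS {}IH raddf_sum /=.
under eq_bigr => i _ do rewrite raddfMn /= mulY_mon mulrnDl.
(* The two extreme terms have a single source each; the inner ones pair up by Pascal's rule. *)
rewrite big_split /= [in LHS]big_ord_recl [X in _ + X]big_ord_recr /=.
rewrite [RHS]big_ord_recl [X in _ = _ + X]big_ord_recr /= !bin0 !binn !subn0 !subnn.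
rewrite -!addrA; congr (_ + _); rewrite addrA -big_split /=; congr (_ + _).
apply: eq_bigr => i _; rewrite /bump /= !add1n subSS binS mulrnDr.
by congr (_ + _); rewrite subnSK.
Qed.

Lemma scale_iter_mulY (K : fieldType) (f : {poly K}) j (b : {poly {poly K}}) :
  f *: iter j mulY b = \sum_(k < size b) \sum_(i < j.+1)
     (('C(j, i)%:R * (f * (b`_k)^`(i)))%:P * 'X^(j + k - i)).
Proof.
rewrite -mul_polyC iter_mulYE exchange_big mulr_sumr /=; apply: eq_bigr => i _.
have -> : map_poly (derivn i) b = \sum_(k < size b) ((b`_k)^`(i))%:P * 'X^k.
  by rewrite /map_poly poly_def; apply: eq_bigr => k _; rewrite mul_polyC.
rewrite -mulr_natl mulr_suml !mulr_sumr; apply: eq_bigr => k _.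
have le_ij : (i <= j)%N by rewrite -ltnS.
rewrite -(mulrA _ 'X^k) -exprD addnBA // [(k + j)%N]addnC !polyCM polyC_natr.
by rewrite mulrCA !mulrA.
Qed.

Lemma wmulE (K : fieldType) (a b : weyl K) : wmul a b = act mulY a b.
Proof. by apply: eq_bigr => j _; rewrite scale_iter_mulY. Qed.

(* [weyl] unfolds to the commutative ring {poly {poly K}}, so the Weyl product
   lives on a copy. *)
Definition weylA (K : fieldType) : Type := weyl K.

Section WeylAlgebra.
Variable K : fieldType.
Implicit Types a b : weylA K.

HB.instance Definition _ := GRing.Zmodule.copy (weylA K) {poly {poly K}}.

Definition weylA_mul : weylA K -> weylA K -> weylA K := act mulY.

Fact weylA_mulA : associative weylA_mul.
Proof. by move=> a b c; rewrite /weylA_mul (act_act (@mulYD K) (@mulYZ K)). Qed.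

Fact weylA_mul1l : left_id (1%:P : weylA K) weylA_mul.
Proof. by move=> a; rewrite /weylA_mul actC scale1r. Qed.

Lemma iter_mulY1 j : iter j mulY 1 = 'X^j :> {poly {poly K}}.
Proof.
elim: j => //= j ->; rewrite /mulY -exprSr -[RHS]addr0; congr (_ + _).
apply/polyP => i; rewrite coef_map coefXn coef0 /=.
by case: eqP => _; rewrite ?derivC // -[1]/(1%:P) derivC.
Qed.

Fact weylA_mulr1 : right_id (1%:P : weylA K) weylA_mul.
Proof.
move=> a; rewrite /weylA_mul /act -[RHS]coefK poly_def.
by apply: eq_bigr => j _; rewrite iter_mulY1.
Qed.

Fact weylA_mulDl : left_distributive weylA_mul +%R.
Proof. by move=> a b c; apply: actDl. Qed.

Fact weylA_mulDr : right_distributive weylA_mul +%R.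
Proof. by move=> a b c; apply: actDr; apply: mulYD. Qed.

Fact weylA_oner_neq0 : (1%:P : weylA K) != 0.
Proof. exact: (oner_neq0 {poly {poly K}}). Qed.

HB.instance Definition _ := GRing.Zmodule_isNzRing.Build (weylA K)
  weylA_mulA weylA_mul1l weylA_mulr1 weylA_mulDl weylA_mulDr weylA_oner_neq0.

Definition weylA_scale (c : K) (a : weylA K) : weylA K :=
  (c%:P : {poly K}) *: (a : {poly {poly K}}).

Fact weylA_scaleA c d a : weylA_scale c (weylA_scale d a) = weylA_scale (c * d) a.
Proof. by rewrite /weylA_scale scalerA polyCM. Qed.

Fact weylA_scale1 : left_id 1 weylA_scale.
Proof. by move=> a; apply: scale1r. Qed.

Fact weylA_scaleDr : right_distributive weylA_scale +%R.
Proof. by move=> c a b; apply: scalerDr. Qed.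

Fact weylA_scaleDl a : {morph weylA_scale^~ a : c d / c + d}.
Proof. by move=> c d; rewrite /weylA_scale polyCD; apply: scalerDl. Qed.

HB.instance Definition _ := GRing.Zmodule_isLmodule.Build K (weylA K)
  weylA_scaleA weylA_scale1 weylA_scaleDr weylA_scaleDl.

Fact weylA_scaleAl (k : K) a b : k *: (a * b) = (k *: a) * b.
Proof. by symmetry; apply: actZl. Qed.

HB.instance Definition _ := GRing.Lmodule_isLalgebra.Build K (weylA K) weylA_scaleAl.

Fact weylA_scaleAr (k : K) a b : k *: (a * b) = a * (k *: b).
Proof.
by symmetry; apply: actZr; apply: mulYZ.
Qed.

HB.instance Definition _ := GRing.Lalgebra_isAlgebra.Build K (weylA K) weylA_scaleAr.

End WeylAlgebra.

(** * Endomorphisms and automorphisms *)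

Section Endo.
Variables (K : fieldType) (P Q : weylA K).
Hypothesis PQ : P * Q = Q * P + 1.

(** Substitution of $Q$ for $X$ and $P$ for $Y$ in the normally ordered form: each $f(X)Y^j$ becomes
    $f(Q)P^j$. *)
Definition endo (a : weylA K) : weylA K := (map_poly (horner_alg Q) a).[P].

Fact endo0 : endo 0 = 0. Proof. by rewrite /endo raddf0 horner0. Qed.

Fact endoD : {morph endo : a b / a + b}.
Proof. by move=> a b; rewrite /endo raddfD hornerD. Qed.

HB.instance Definition _ :=
  GRing.isNmodMorphism.Build (weylA K) (weylA K) endo (conj endo0 endoD).

Lemma endo_scale (f : {poly K}) (b : {poly {poly K}}) :
  endo (f *: b) = horner_alg Q f * endo b.
Proof. by rewrite /endo linearZ hornerZ. Qed.

Lemma endoZ (k : K) a : endo (k *: a) = k *: endo a.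
Proof. by rewrite endo_scale horner_algC mulr_algl. Qed.

Lemma endo_polyC (f : {poly K}) : endo f%:P = horner_alg Q f.
Proof. by rewrite /endo map_polyC hornerC. Qed.

Lemma endo1 : endo 1 = 1. Proof. by rewrite endo_polyC rmorph1. Qed.

Lemma endoX : endo (wX K) = Q. Proof. by rewrite endo_polyC horner_algX. Qed.

Lemma endoY : endo (wY K) = P.
Proof. by rewrite /endo map_polyX hornerX. Qed.

(** By the relation [PQ], the commutator with $P$ is the derivation of $K[Q]$ sending $Q$ to 1. This
    is what makes the substitution compatible with [mulY], hence multiplicative. *)
Lemma mulP_horner f :
  P * horner_alg Q f = horner_alg Q f * P + horner_alg Q f^`().
Proof.
elim/poly_ind: f => [|f c IH]; first by rewrite deriv0 !rmorph0 mulr0 mul0r addr0.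
rewrite derivD derivC addr0 derivM derivX mulr1 !rmorphD !rmorphM /= horner_algX.
rewrite horner_algC; set h := horner_alg Q f in IH *; set h' := horner_alg Q _ in IH *.
rewrite mulrDr mulrDl mulrA IH mulrDl -(mulrA h P) PQ mulrDr mulr1 mulrA.
by rewrite mulr_algl mulr_algr -!addrA; congr (_ + _); rewrite addrA addrC [h + _]addrC.
Qed.

Lemma endo_mulY b : endo (mulY b) = P * endo b.
Proof.
elim/poly_ind: b => [|b f IH]; first by rewrite mulY0 endo0 mulr0.
have endoMX c : endo (c * 'X : {poly {poly K}}) = endo c * P.
  by rewrite /endo rmorphM /= map_polyX hornerMX.
rewrite mulYD endoD mulYX mulYC !endoD mulrDr !endoMX IH -mulrA.
by rewrite !endo_polyC mulP_horner.
Qed.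


Lemma endoM a b : endo (a * b) = endo a * endo b.
Proof.
have -> : endo a = \sum_(j < size (a : {poly {poly K}}))
    horner_alg Q (a : {poly {poly K}})`_j * P ^+ j.
  rewrite /endo (@horner_coef_wide _ (size (a : {poly {poly K}}))) ?size_poly //.
  by apply: eq_bigr => j _; rewrite coef_map.
rewrite raddf_sum mulr_suml; apply: eq_bigr => j _ /=.
rewrite endo_scale -mulrA; congr (_ * _).
elim: (nat_of_ord j) => [|i IH]; first by rewrite mul1r.
by rewrite iterS endo_mulY IH exprS mulrA.
Qed.

End Endo.

(** * Composition of automorphisms; shears and linear maps *)

Section Aut.
Variable K : fieldType.
Local Notation X := (wX K : weylA K).
Local Notation Y := (wY K : weylA K).
Implicit Types (a b P Q : weylA K).

Lemma mulr_wY a : a * Y = ((a : {poly {poly K}}) * 'X : {poly {poly K}}).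
Proof.
rewrite -[RHS]weylA_mulr1 /weylA_mul actMX; congr act.
by rewrite mulYC mul1r derivC addr0.
Qed.

Lemma wmul_weylA a b : wmul a b = a * b. Proof. exact: wmulE. Qed.

Lemma wKE (k : K) : wK k = k%:A :> weylA K.
Proof. by rewrite /wK -[RHS]mul_polyC mulr1. Qed.

Lemma mul_wY a : Y * a = mulY a.
Proof.
have -> : Y = 1%:P * 'X :> {poly {poly K}} by rewrite mul1r.
by rewrite [LHS]actMX actC scale1r.
Qed.

Lemma mul_wY_wX : Y * X = X * Y + 1.
Proof.
by rewrite mulr_wY mul_wY mulYC derivX.
Qed.

Lemma endoMX P Q (c : {poly {poly K}}) : endo P Q (c * 'X) = endo P Q c * P.
Proof. by rewrite /endo rmorphM /= map_polyX hornerMX. Qed.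

Lemma endo_endo P Q P' Q' a : P * Q = Q * P + 1 ->
  endo P Q (endo P' Q' a) = endo (endo P Q P') (endo P Q Q') a.
Proof.
move=> PQ; elim/poly_ind: a => [|b f IH]; first by rewrite !raddf0.
rewrite ![endo _ _ (_ + _)]endoD !endoMX !endo_polyC endoM // IH; congr (_ + _).
elim/poly_ind: f => [|f c IHf]; first by rewrite !rmorph0 raddf0.
rewrite !rmorphD !rmorphM /= !horner_algX !horner_algC endoD endoM // IHf.
by rewrite endoZ endo1.
Qed.

Lemma endo_id a : endo Y X a = a.
Proof.
elim/poly_ind: a => [|b f IH]; first by rewrite raddf0.
rewrite endoD endoMX IH endo_polyC mulr_wY; congr (_ + _).
elim/poly_ind: f => [|f c IHf]; first by rewrite rmorph0.
rewrite rmorphD rmorphM /= horner_algX horner_algC IHf polyCD -wKE; congr (_ + _).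
by rewrite [LHS]actC -mul_polyC -polyCM.
Qed.

(** By [endo_endo] and [endo_id], these conditions make [endo P Q] a left inverse of [endo P' Q'];
    imposed in both orders, they give bijectivity. *)
Definition mutually_inverse P Q P' Q' :=
  [/\ P * Q = Q * P + 1, endo P Q P' = Y & endo P Q Q' = X].

Lemma endo_aut P Q P' Q' :
  mutually_inverse P Q P' Q' -> mutually_inverse P' Q' P Q -> weyl_aut (endo P Q).
Proof.
move=> [PQ eP' eQ'] [PQ' eP eQ]; split.
- exists (endo P' Q') => a.
    by rewrite endo_endo // eP eQ endo_id.
  by rewrite endo_endo // eP' eQ' endo_id.
- exact: endoD.
- by move=> c a; rewrite !wmul_weylA wKE !mulr_algl endoZ.
- by move=> a b; rewrite !wmul_weylA endoM.
- exact: endo1.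
Qed.

Definition tame P Q := exists tau, [/\ weyl_aut tau, P = tau Y & Q = tau X].

Lemma tame_aut sigma P Q : weyl_aut sigma -> tame P Q -> tame (sigma P) (sigma Q).
Proof.
move=> [bs sD sZ sM s1] [tau [[bt tD tZ tM t1] -> ->]].
exists (sigma \o tau); split=> //; split=> [|a b|c a|a b|] /=.
- exact: bij_comp.
- by rewrite tD sD.
- by rewrite tZ sZ.
- by rewrite tM sM.
- by rewrite t1.
Qed.

Lemma tame_endo P Q P' Q' :
  mutually_inverse P Q P' Q' -> mutually_inverse P' Q' P Q -> tame P Q.
Proof.
move=> PQ PQ'; exists (endo P Q); split; first exact: endo_aut PQ PQ'.
  by rewrite endoY.
by rewrite endoX.
Qed.

Lemma endo_exp P Q a n : P * Q = Q * P + 1 -> endo P Q (a ^+ n) = endo P Q a ^+ n.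
Proof.
move=> PQ; elim: n => [|n IH]; first by rewrite !expr0 endo1.
by rewrite !exprS endoM // IH.
Qed.

Lemma shearY_inverse (c : K) n :
  mutually_inverse (Y + c *: X ^+ n) X (Y - c *: X ^+ n) X.
Proof.
have comm : (Y + c *: X ^+ n) * X = X * (Y + c *: X ^+ n) + 1.
  by rewrite mulrDl mulrDr mul_wY_wX -scalerAl -scalerAr -exprS -exprSr addrAC.
by split; rewrite ?endoX // raddfB /= endoY endoZ endo_exp // endoX addrK.
Qed.

Lemma shearX_inverse (c : K) n :
  mutually_inverse Y (X + c *: Y ^+ n) Y (X - c *: Y ^+ n).
Proof.
have comm : Y * (X + c *: Y ^+ n) = (X + c *: Y ^+ n) * Y + 1.
  by rewrite mulrDl mulrDr mul_wY_wX -scalerAl -scalerAr -exprS -exprSr addrAC.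
by split; rewrite ?endoY // raddfB /= endoX endoZ endo_exp // endoY addrK.
Qed.

Lemma shearY_aut (c : K) n : weyl_aut (endo (Y + c *: X ^+ n) X).
Proof.
apply: endo_aut (shearY_inverse c n) _.
by have := shearY_inverse (- c) n; rewrite scaleNr opprK.
Qed.

Lemma shearX_aut (c : K) n : weyl_aut (endo Y (X + c *: Y ^+ n)).
Proof.
apply: endo_aut (shearX_inverse c n) _.
by have := shearX_inverse (- c) n; rewrite scaleNr opprK.
Qed.

(** The number $bc - ad$ is the commutator of the two linear forms, and the inverse pair comes from
    the inverse matrix. *)
Lemma linear_inverse (a b c d : K) : b * c - a * d = 1 ->
  mutually_inverse (a *: X + b *: Y) (c *: X + d *: Y)
                   (c *: Y - a *: X) (b *: X - d *: Y).
Proof.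
move=> det; split.
- have <- : (b * c)%:A - (a * d)%:A = 1 :> weylA K by rewrite -scalerBl det scale1r.
  rewrite !mulrDl !mulrDr -!scalerAl -!scalerAr mul_wY_wX !scalerDr !scalerA.
  rewrite (mulrC c a) (mulrC c b) (mulrC d a) (mulrC d b).
  by rewrite [RHS](AC (2*3*2) ((1*3)*(2*6*5)*(4*7))) /= subrr addr0.
- rewrite raddfB /= !endoZ endoX endoY !scalerDr !scalerA (mulrC c a).
  by rewrite opprD addrACA subrr add0r -scalerBl (mulrC c b) det scale1r.
- rewrite raddfB /= !endoZ endoX endoY !scalerDr !scalerA (mulrC b d).
  by rewrite opprD addrACA subrr addr0 -scalerBl (mulrC d a) det scale1r.
Qed.

Lemma tame_linear (a b c d : K) : b * c - a * d = 1 ->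
  tame (a *: X + b *: Y) (c *: X + d *: Y).
Proof.
move=> det; apply: tame_endo (linear_inverse det) _.
(* The inverse pair has the same shape and the same determinant. *)
have := @linear_inverse (- a) c b (- d); rewrite mulrNN [c * b]mulrC => /(_ det).
by rewrite !scaleNr !opprK [- _ + _]addrC [b *: Y + _]addrC [c *: X + _]addrC.
Qed.

(** Precompose with the rotation $Y \mapsto -X$, $X \mapsto Y$. It reduces the case of degree $-1$
    in [P] to that of degree 1. *)
Lemma tame_swap P Q : tame Q (- P) -> tame P Q.
Proof.
move=> [tau [tau_aut -> /(congr1 -%R)]]; rewrite opprK => ->.
have := @tame_linear (-1) 0 0 1; rewrite mul0r mulN1r sub0r opprK => /(_ erefl).
move=> /(tame_aut tau_aut); rewrite !scale0r addr0 add0r scale1r scaleN1r.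
case: tau_aut => _ tauD _ _ _; congr (tame _ _).
have tau0 : tau 0 = 0 by apply: (addIr (tau 0)); rewrite -tauD !add0r.
by apply/eqP; rewrite -addr_eq0 -tauD addNr tau0.
Qed.

Lemma tame_shears (l r m v : K) i j : - (l * m) = 1 -> (i == 0) || (j == 0) ->
  tame (l *: X + r *: Y ^+ i) (m *: Y + v *: X ^+ j).
Proof.
move=> lm.
have l0 : l != 0 by apply/eqP => l0; move/eqP: lm; rewrite l0 mul0r oppr0 eq_sym oner_eq0.
have m0 : m != 0 by apply/eqP => m0; move/eqP: lm; rewrite m0 mulr0 oppr0 eq_sym oner_eq0.
have tame_diag : tame (l *: X) (m *: Y).
  have := @tame_linear l 0 0 m; rewrite mul0r sub0r => /(_ lm).
  by rewrite !scale0r addr0 add0r.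
have lr : l * (l^-1 * r) = r by rewrite mulrA mulfV ?mul1r.
have mv : m * (m^-1 * v) = v by rewrite mulrA mulfV ?mul1r.
(* The exponent 0 makes one shear a translation. It is applied first, since the constant it adds is
   fixed by the second shear. *)
case/orP => /eqP ->.
  have := tame_aut (shearX_aut (l^-1 * r) 0) tame_diag.
  move=> /(tame_aut (shearY_aut (m^-1 * v) j)).
  rewrite !endoZ endoX endoY !raddfD /= !endoZ !expr0.
  by rewrite endo1 endoX endoY !scalerDr !scalerA lr mv.
have := tame_aut (shearY_aut (m^-1 * v) 0) tame_diag.
move=> /(tame_aut (shearX_aut (l^-1 * r) i)).
rewrite !endoZ endoX endoY !raddfD /= !endoZ !expr0.
by rewrite endo1 endoX endoY !scalerDr !scalerA lr mv.
Qed.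

End Aut.

(** * Commutators of symbols *)

Section Shift.
Variable K : fieldType.
Implicit Types (p q : {poly K}) (i j k : int).

Definition shift k p := p \Po ('X + k%:~R%:P).

Lemma size_shift k p : size (shift k p) = size p.
Proof. by rewrite size_comp_poly2 // size_XaddC. Qed.

Lemma shift_horner k p x : (shift k p).[x] = p.[x + k%:~R].
Proof. by rewrite horner_comp !hornerE. Qed.

(** Taylor expansion: $p(N+k) - p$ drops the degree by one, and subtracting $k p'$ as well drops it
    by two. *)
Lemma size_shift_taylor k p :
  (size (shift k p - p)%R <= (size p).-1)%N /\
  (size (shift k p - p - k%:~R *: p^`())%R <= (size p).-2)%N.
Proof.
elim/poly_ind: p => [|p c [IH1 IH2]].
  by rewrite /shift comp_poly0 deriv0 scaler0 !subr0 size_poly0.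
have [-> | p0] := eqVneq p 0.
  by rewrite mul0r add0r /shift comp_polyC derivC scaler0 !subr0 subrr size_poly0.
rewrite size_MXaddC (negPf p0) /=.
have shiftE : shift k (p * 'X + c%:P) = shift k p * ('X + k%:~R%:P) + c%:P.
  by rewrite /shift comp_polyD comp_polyM comp_polyX comp_polyC.
have sp : (0 < size p)%N by rewrite size_poly_gt0.
have leMX q n : (size q <= n)%N -> (size (q * 'X)%R <= n.+1)%N.
  by have [->|q0] := eqVneq q 0; rewrite ?mul0r ?size_poly0 // size_mulX.
split.
  have -> : shift k (p * 'X + c%:P) - (p * 'X + c%:P)
      = (shift k p - p) * 'X + k%:~R *: shift k p.
    by rewrite shiftE -mul_polyC; ring.
  rewrite (leq_trans (size_polyD _ _)) // geq_max.
  rewrite (leq_trans (size_scale_leq _ _)) ?size_shift // andbT.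
  by rewrite -(prednK sp) leMX // (leq_trans IH1).
have -> : shift k (p * 'X + c%:P) - (p * 'X + c%:P)
      - k%:~R *: (p * 'X + c%:P)^`()
    = (shift k p - p - k%:~R *: p^`()) * 'X + k%:~R *: (shift k p - p).
  by rewrite shiftE -!mul_polyC derivD derivC derivM derivX; ring.
rewrite (leq_trans (size_polyD _ _)) // geq_max.
rewrite (leq_trans (size_scale_leq _ _)) // andbT.
move: (_ - _) IH2 => T; have [->|T0] := eqVneq T 0.
  by rewrite mul0r size_poly0.
rewrite size_mulX //; move: T0; rewrite -size_poly_gt0.
by case: (size p) => [|[|n]]; case: (size T).
Qed.


(** The factor that acts second sees the exponent already moved by the first: $t^n$ has become
    $t^{n+j}$ when [p] is evaluated, whence [shift j p]. *)
Definition br i p j q := shift j p * q - shift i q * p.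

Lemma br_antisym i p j q : br i p j q = - br j q i p.
Proof. by rewrite /br opprB. Qed.

Lemma br0r i p j : br i p j 0 = 0.
Proof. by rewrite /br /shift comp_poly0 mulr0 mul0r subr0. Qed.

Lemma br0l i j q : br i 0 j q = 0.
Proof. by rewrite br_antisym br0r oppr0. Qed.

Lemma brBr i p j q r : br i p j (q - r) = br i p j q - br i p j r.
Proof. by rewrite /br /shift comp_polyB; ring. Qed.

Lemma brZr i p j c q : br i p j (c *: q) = c *: br i p j q.
Proof. by rewrite /br /shift comp_polyZ -!mul_polyC; ring. Qed.

Lemma br_id i p : br i p i p = 0.
Proof. by rewrite /br subrr. Qed.

Lemma br_expand i p j q m n : size p = m.+1 -> size q = n.+1 ->
  (size (br i p j q) <= m + n)%N /\
  (br i p j q)`_(m + n).-1 =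
     (j * m%:Z - i * n%:Z)%:~R * (lead_coef p * lead_coef q).
Proof.
(* The second-order remainders [E] and [F] contribute only below degree $m+n-1$. *)
move=> sp sq; have [_ sE] := size_shift_taylor j p; have [_ sF] := size_shift_taylor i q.
set E := shift j p - _ - _ in sE; set F := shift i q - _ - _ in sF.
have -> : br i p j q = j%:~R *: (p^`() * q) - i%:~R *: (q^`() * p) + (E * q - F * p).
  by rewrite /br /E /F -!mul_polyC; ring.
have size_mul_le (f g : {poly K}) a b :
    (size f <= a)%N -> (size g <= b.+1)%N -> (size (f * g)%R <= a + b)%N.
  move=> sf sg; apply: leq_trans (size_polyMleq f g) _; lia.
have small (f g : {poly K}) a b :
    (size f <= a.-1)%N -> (size g <= b.+1)%N -> (size (f * g)%R <= (a + b).-1)%N.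
  move=> sf sg; have [->|f0] := eqVneq f 0; first by rewrite mul0r size_poly0.
  apply: leq_trans (size_polyMleq f g) _; move: f0; rewrite -size_poly_gt0; lia.
have top (f g : {poly K}) a b : size f = a.+1 -> size g = b.+1 ->
    (f^`() * g)`_(a + b).-1 = a%:R * (lead_coef f * lead_coef g).
  case: a => [/eqP/size_poly1P[c _ ->] _|a sf sg].
    by rewrite derivC mul0r coef0 mul0r.
  have sg' : (size g <= b.+1)%N by rewrite sg.
  have sf' : (size f^`() <= a.+1)%N by rewrite -ltnS -sf lt_size_deriv // -size_poly_gt0 sf.
  rewrite addSn /= coefM (bigD1 (Ordinal (leq_addr b a : (a < (a + b).+1)%N))) //=.
  rewrite addKn big1 ?addr0 => [|k /eqP ne_k].
    by rewrite coef_deriv /lead_coef sf sg /= mulrA mulr_natl.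
  have [lt_ka|le_ak] := ltnP k a.
    by rewrite [X in _ * X]nth_default ?mulr0 // (leq_trans sg') //; lia.
  rewrite nth_default ?mul0r // (leq_trans sf') // ltn_neqAle le_ak andbT.
  by apply/eqP => ak; apply: ne_k; apply/val_inj.
have le_p : (size p <= m.+1)%N by rewrite sp.
have le_q : (size q <= n.+1)%N by rewrite sq.
have sp' : (size p^`() <= m)%N by rewrite -ltnS -sp lt_size_deriv // -size_poly_gt0 sp.
have sq' : (size q^`() <= n)%N by rewrite -ltnS -sq lt_size_deriv // -size_poly_gt0 sq.
rewrite sp /= in sE; rewrite sq /= in sF.
have sEF : (size (E * q - F * p)%R <= (m + n).-1)%N.
  rewrite (leq_trans (size_polyD _ _)) // geq_max size_polyN small //.
  by rewrite addnC small.
split.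
  rewrite (leq_trans (size_polyD _ _)) // geq_max (leq_trans sEF) ?leq_pred // andbT.
  rewrite (leq_trans (size_polyD _ _)) // geq_max size_polyN.
  apply/andP; split; apply: leq_trans (size_scale_leq _ _) _.
    exact: size_mul_le.
  by rewrite addnC; apply: size_mul_le.
rewrite coefD [X in _ + X]nth_default // addr0 coefB !coefZ (top _ _ _ _ sp sq).
by rewrite [in X in _ - X]addnC (top _ _ _ _ sq sp); ring.
Qed.

Hypothesis hK : [pchar K] =i pred0.

Lemma intr_eq0_pchar0 i : (i%:~R == 0 :> K) = (i == 0).
Proof.
have nat0 := (pcharf0P K).1 hK.
by case: i => n; rewrite ?NegzE ?mulrNz ?oppr_eq0 -pmulrn nat0.
Qed.

Lemma size_br_le i p j q m n : size p = m.+1 -> size q = n.+1 ->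
  (size (br i p j q) <= m + n)%N.
Proof. by move=> sp sq; case: (br_expand i j sp sq). Qed.

Lemma size_br i p j q m n : size p = m.+1 -> size q = n.+1 ->
  j * m%:Z != i * n%:Z -> size (br i p j q) = (m + n)%N.
Proof.
move=> sp sq ne; have [le_s top] := br_expand i j sp sq.
apply/eqP; rewrite eqn_leq le_s /=.
(* Needed for the index [(m + n).-1] to be a true predecessor. *)
have mn0 : (0 < m + n)%N.
  by rewrite lt0n addn_eq0; apply: contra ne => /andP[/eqP-> /eqP->]; rewrite !mulr0.
rewrite -(prednK mn0) ltnNge; apply/negP => /leq_sizeP /(_ _ (leqnn _)) /eqP.
rewrite top !mulf_eq0 intr_eq0_pchar0 subr_eq0 (negPf ne).
by rewrite !lead_coef_eq0 -!size_poly_eq0 sp sq.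
Qed.

End Shift.

(** * Symbols of homogeneous components *)

Section Symbol.
Variable K : fieldType.
Implicit Types (a b : weylA K) (d e : int).

(** The coefficient of $X^{j+d}Y^j$; the test on the sign keeps [absz] from reading a wrong
    coefficient when $j+d$ is negative. *)
Definition diag d a (j : nat) : K :=
  if 0 <= j%:Z + d then ((a : {poly {poly K}})`_j)`_(absz (j%:Z + d)) else 0.

(** The falling factorial, by which $X^{j+d}Y^j$ scales $t^n$ when sending it to $t^{n+d}$. *)
Definition fallfact j : {poly K} := \prod_(i < j) ('X - i%:R%:P).

(* On [K[t]], with [X = t] and [Y = d/dt], the degree [d] component of [a]
   maps [t^n] to [(symbol d a).[n] t^(n+d)]. *)
Definition symbol d a : {poly K} :=
  \sum_(j < size (a : {poly {poly K}})) diag d a j *: fallfact j.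

Lemma size_fallfact j : size (fallfact j) = j.+1.
Proof. by rewrite size_prod_XsubC /index_enum -enumT size_enum_ord. Qed.

Lemma fallfact_nat j n : (fallfact j).[n%:R] = (n ^_ j)%:R.
Proof.
rewrite horner_prod; under eq_bigr do rewrite hornerXsubC.
elim: j => [|j IH]; first by rewrite big_ord0 ffactn0.
rewrite big_ord_recr /= IH ffactnSr natrM; have [le_jn|lt_nj] := leqP j n.
  by rewrite natrB.
by rewrite ffact_small // !mul0r.
Qed.

Lemma diag_default d a j : (size (a : {poly {poly K}}) <= j)%N -> diag d a j = 0.
Proof.
move=> le_aj; rewrite /diag; have -> : (a : {poly {poly K}})`_j = 0 by apply: nth_default.
by rewrite coef0 if_same.
Qed.

Lemma symbolE n d a : (size (a : {poly {poly K}}) <= n)%N ->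
  symbol d a = \sum_(j < n) diag d a j *: fallfact j.
Proof.
move=> le_an; rewrite /symbol (big_ord_widen n (fun j => diag d a j *: fallfact j)) //.
rewrite big_mkcond; apply: eq_bigr => i _; case: ltnP => // le_i.
by rewrite diag_default // scale0r.
Qed.

Lemma symbolD d : {morph symbol d : a b / a + b}.
Proof.
move=> a b; set n := maxn (size (a : {poly {poly K}})) (size (b : {poly {poly K}})).
rewrite !(@symbolE n) ?leq_maxl ?leq_maxr ?size_polyD // -big_split.
apply: eq_bigr => i _ /=; rewrite -scalerDl /diag !coefD.
by case: ifP => // _; rewrite addr0.
Qed.

Lemma symbolZ d (k : K) a : symbol d (k *: a) = k *: symbol d a.
Proof.
rewrite (@symbolE (size (a : {poly {poly K}}))) ?size_scale_leq // scaler_sumr.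
apply: eq_bigr => i _; rewrite scalerA /diag coefZ coefCM.
by case: ifP => // _; rewrite mulr0.
Qed.

Lemma symbolB d a b : symbol d (a - b) = symbol d a - symbol d b.
Proof. by rewrite symbolD -[- b]scaleN1r symbolZ scaleN1r. Qed.

(** Falling factorials have distinct degrees, so the degree of a nonzero symbol is the last index
    with nonzero [diag]. *)
Variant symbol_spec d a : {poly K} -> Prop :=
| Symbol0 of (forall j, diag d a j = 0) : symbol_spec d a 0
| SymbolS j (p : {poly K}) of size p = j.+1 & diag d a j != 0
    & (forall k, (j < k)%N -> diag d a k = 0) : symbol_spec d a p.

Lemma symbolP d a : symbol_spec d a (symbol d a).
Proof.
rewrite /symbol; set n := size _.
have : forall j, (n <= j)%N -> diag d a j = 0 by move=> j; apply: diag_default.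
elim: n => [|n IH] a0; first by rewrite big_ord0; constructor => j; apply: a0.
have [an0|an0] := eqVneq (diag d a n) 0.
  rewrite big_ord_recr /= an0 scale0r addr0; apply: IH => j.
  by rewrite leq_eqVlt => /predU1P[<- //|]; apply: a0.
apply: (@SymbolS _ _ n) => //; rewrite big_ord_recr /= addrC size_polyDl.
  by rewrite size_scale // size_fallfact.
rewrite size_scale // size_fallfact ltnS (leq_trans (size_sum _ _ _)) //.
apply/bigmax_leqP => i _; rewrite (leq_trans (size_scale_leq _ _)) //.
by rewrite size_fallfact.
Qed.

Lemma symbol_eq0 d a j : symbol d a = 0 -> diag d a j = 0.
Proof.
by case: symbolP => // i p sp _ _ p0; move: sp; rewrite p0 size_poly0.
Qed.

Lemma symbol_inj a b : (forall d, symbol d a = symbol d b) -> a = b.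
Proof.
move=> eq_ab; apply/eqP; rewrite -subr_eq0; apply/eqP.
have ab0 d j : diag d (a - b) j = 0.
  by apply: symbol_eq0; rewrite symbolB eq_ab subrr.
apply/polyP => j; apply/polyP => i; rewrite !coef0.
by have := ab0 (i%:Z - j%:Z) j; rewrite /diag addrC subrK.
Qed.

(** The leading term comes from a monomial $X^{n+d}Y^n$, whose exponents are natural. Components of
    negative degree thus have symbols of large degree. *)
Lemma size_symbol_ge d a n : size (symbol d a) = n.+1 -> 0 <= n%:Z + d.
Proof.
case: symbolP => [_|j p -> nz _ [<-]]; first by rewrite size_poly0.
by move: nz; rewrite /diag; case: ifP => //; rewrite eqxx.
Qed.

(** Indices below [n] would need a negative power of $X$, and those above are excluded by the size:
    only $Y^n$ remains. *)
Lemma symbol_extremal d a n : n%:Z + d = 0 -> (size (symbol d a) <= n.+1)%N ->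
  exists c, symbol d a = c *: fallfact n.
Proof.
move=> nd; have diag_lt j : (j < n)%N -> diag d a j = 0.
  by move=> lt_jn; rewrite /diag ifN // -ltNge -nd; lia.
have diag_gt : (size (symbol d a) <= n.+1)%N -> forall j, (n < j)%N -> diag d a j = 0.
  case: symbolP => // j p -> _ jk le_jn k lt_nk.
  by apply: jk; apply: leq_ltn_trans lt_nk.
move=> /diag_gt gt; exists (diag d a n).
set N := maxn n.+1 (size (a : {poly {poly K}})).
have lt_nN : (n < N)%N by rewrite leq_maxl.
rewrite (@symbolE N) ?leq_maxr // (bigD1 (Ordinal lt_nN)) //= big1 ?addr0 // => i ne.
case: (ltngtP i n) => [lt|lt|eq_in].
- by rewrite diag_lt // scale0r.
- by rewrite gt // scale0r.
by case/eqP: ne; apply: val_inj.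
Qed.

End Symbol.

(** * Elements with two components; symbols of products *)

Section Support.
Variable K : fieldType.
Implicit Types (a b : weylA K) (c d e : int).

Definition supported c d a :=
  forall e, e != c -> e != d -> symbol e a = 0.

Lemma coef_wcomp d (a : weyl K) j i :
  ((wcomp d a)`_j)`_i = if i%:Z - j%:Z == d then (a`_j)`_i else 0.
Proof.
rewrite coef_poly; case: ltnP => [_|le_aj].
  by rewrite coef_poly; case: ltnP => // ?; rewrite nth_default // if_same.
by rewrite [a`_j]nth_default // !coef0 if_same.
Qed.

Lemma mass_supported (a : weyl K) : (wmass a <= 2)%N ->
  exists c d, c != d /\ supported c d a.
Proof.
rewrite /wmass -size_filter; set s := filter _ _ => le_s.
have mem_s e : symbol e a != 0 -> e \in s.
  case: symbolP => [_|j p _ nz _ _]; first by rewrite eqxx.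
  move: nz; rewrite /diag; case: ifP => [ge0 nz|]; last by rewrite eqxx.
  set i := absz _ in nz; have ie : i%:Z = j%:Z + e by rewrite gez0_abs.
  have lt_j : (j < size a)%N.
    by rewrite ltnNge; apply: contraNN nz => le_aj; rewrite [a`_j]nth_default // coef0.
  have lt_i : (i < size (a`_j)%R)%N.
    by rewrite ltnNge; apply: contraNN nz => le_i; rewrite nth_default.
  rewrite mem_filter; apply/andP; split.
    apply: contraNneq nz => w0; have := coef_wcomp e a j i.
    by rewrite w0 !coef0 ie addrC addKr eqxx => <-.
  have le_i : (size (a`_j)%R <= \sum_(k < size a) size (a`_k)%R)%N.
    by rewrite (bigD1 (Ordinal lt_j)) //= leq_addr.
  apply/mapP; exists (absz (e + (wbound a)%:Z)).
    by rewrite mem_iota /wbound; lia.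
  by rewrite gez0_abs ?addrK // /wbound; lia.
have {mem_s} sup e : e \notin s -> symbol e a = 0.
  by move=> es; apply/eqP; apply: contraNT es => /mem_s.
case: s le_s sup => [|x [|y [|? ?]]] // _ sup.
(* Missing degrees are filled in arbitrarily, since [supported] allows zero components. *)
- by exists 0, 1; split=> // e _ _; apply: sup.
- by exists x, (x + 1); split=> [|e ex _]; [lia | apply: sup; rewrite inE].
have [exy|nexy] := eqVneq x y.
  exists x, (x + 1); split=> [|e ex _]; first by lia.
  by apply: sup; rewrite !inE -exy orbb.
by exists x, y; split=> // e ex ey; apply: sup; rewrite !inE negb_or ex.
Qed.

Definition diffop (a : weylA K) (f : {poly K}) : {poly K} :=
  @act K {poly K}^o (@deriv K) a f.

Lemma coef_diffop a n k :
  (diffop a 'X^n)`_k = (symbol (k%:Z - n%:Z) a).[n%:R].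
Proof.
rewrite /diffop /act /symbol coef_sum horner_sum; apply: eq_bigr => j _.
have -> : iter j (@deriv K) 'X^n = ('X^n)^`(j) by [].
rewrite hornerZ fallfact_nat derivnXn.
transitivity (((a : {poly {poly K}})`_j * 'X^(n - j) *+ n ^_ j)`_k).
  by congr (_`_k); rewrite -mulrnAr.
rewrite coefMn coefMXn mulr_natr; have [le_jn|lt_nj] := leqP j n; last first.
  by rewrite ffact_small // !mulr0n.
rewrite /diag; case: ltnP => cmp.
  by rewrite ifN //; lia.
by rewrite ifT; [congr (_`_ _ *+ _); lia|lia].
Qed.

Hypothesis hK : [pchar K] =i pred0.

(** In characteristic zero the naturals from [N] on are infinitely many points. The bound [N] lets
    symbols be compared only where all shifted exponents are natural. *)
Lemma poly_nat_inj (p q : {poly K}) N :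
  (forall n, (N <= n)%N -> p.[n%:R] = q.[n%:R]) -> p = q.
Proof.
move=> eq_pq; apply/eqP; rewrite -subr_eq0; apply/negPn/negP => r0.
pose rs : seq K := [seq n%:R | n <- iota N (size (p - q))].
suff: (size rs < size (p - q)%R)%N by rewrite size_map size_iota ltnn.
apply: max_poly_roots => //.
  apply/allP => _ /mapP[n + ->]; rewrite mem_iota => /andP[le_n _].
  by rewrite rootE hornerD hornerN eq_pq // subrr.
rewrite map_inj_uniq ?iota_uniq // => n k /eqP; rewrite -subr_eq0 => nk.
have := intr_eq0_pchar0 hK (n%:Z - k%:Z); rewrite rmorphB /= nk.
by move=> /esym; lia.
Qed.


Lemma symbol_mul c d e a b : c != d -> supported c d b ->
  symbol e (a * b) = shift c (symbol (e - c) a) * symbol c b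
                   + shift d (symbol (e - d) a) * symbol d b.
Proof.
(* For such [n] the exponents $n+c$, $n+d$, $n+e$ are nonnegative; compare the coefficients of
   $t^{n+e}$ in $a(b\,t^n)$. *)
move=> ne_cd sup; apply: (@poly_nat_inj _ _ (absz c + absz d + absz e)) => n le_n.
pose m i := absz (n%:Z + i).
have mE i : (absz i <= n)%N -> (m i)%:Z = n%:Z + i by rewrite /m; lia.
have [mc md me] : [/\ (m c)%:Z = n%:Z + c, (m d)%:Z = n%:Z + d & (m e)%:Z = n%:Z + e].
  by split; apply: mE; lia.
have -> : e = (m e)%:Z - n%:Z by rewrite me addrC addKr.
rewrite -coef_diffop [diffop _ _]act_act; first last.
- by move=> f g; apply: derivM.
- exact: derivD.
have -> : act (M := {poly K}^o) (@deriv K) b 'X^n =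
    (symbol c b).[n%:R]%:P *: ('X^(m c) : {poly K}^o)
    + (symbol d b).[n%:R]%:P *: ('X^(m d) : {poly K}^o).
  apply/polyP => k; rewrite [LHS]coef_diffop coefD ![_%:P *: _]mul_polyC !coefZ !coefXn.
  have kE i : (k == m i) = (k%:Z - n%:Z == (m i)%:Z - n%:Z) by lia.
  rewrite !kE mc md ![n%:Z + _ - _]addrC !addKr.
  have [->|ne_c] := eqVneq (k%:Z - n%:Z) c.
    by rewrite (negPf ne_cd) mulr1 mulr0 addr0.
  have [->|ne_d] := eqVneq (k%:Z - n%:Z) d; first by rewrite mulr1 mulr0 add0r.
  by rewrite sup // horner0 !mulr0 addr0.
rewrite actDr; last exact: derivD.
rewrite !actZr; first last.
  by move=> f g; apply: derivM.
  by move=> f g; apply: derivM.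
rewrite coefD ![_%:P *: _]mul_polyC !coefZ -![act _ _ _]/(diffop _ _) !coef_diffop.
rewrite hornerD !hornerM !shift_horner mc md ![n%:Z + _]addrC.
have natE i : (0 <= n%:Z + i) -> (absz (n%:Z + i))%:R = n%:R + i%:~R :> K.
  by move=> ge0; rewrite pmulrn gez0_abs // rmorphD.
rewrite -!natE; first last.
- by rewrite -mc.
- by rewrite -md.
rewrite -/(m c) -/(m d) ![_ * (symbol _ b).[_]]mulrC.
by rewrite !opprD ![- _ - n%:Z]addrC !addrA.
Qed.

End Support.

(** * Classification *)

Section CommutingSymbols.
Variable K : fieldType.
Hypothesis hK : [pchar K] =i pred0.
Local Notation X := (wX K : weylA K).
Local Notation Y := (wY K : weylA K).
Implicit Types (P Q : weylA K) (a b c d e : int) (p q : {poly K}).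

Lemma size_polyS p : p != 0 -> exists m, size p = m.+1.
Proof. by rewrite -size_poly_gt0; case: (size p) => // m _; exists m. Qed.

Lemma br_eq0_size a p b q m n : size p = m.+1 -> size q = n.+1 ->
  br a p b q = 0 -> b * m%:Z = a * n%:Z.
Proof.
move=> sp sq br0; apply/eqP; apply/negPn/negP => ne.
have := size_br hK sp sq ne; rewrite br0 size_poly0 => /esym/eqP.
rewrite addn_eq0 => /andP[/eqP m0 /eqP n0].
by move/eqP: ne; rewrite m0 n0 !mulr0.
Qed.

Lemma br_eq1_size a p q : br a p (- a) q = 1 ->
  exists m n, [/\ size p = m.+1, size q = n.+1 & (m + n)%N = 1%N].
Proof.
move=> br1; have br_n0 : br a p (- a) q != 0 by rewrite br1 oner_neq0.
have [m sp] : exists m, size p = m.+1.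
  by apply: size_polyS; apply: contraNneq br_n0 => ->; rewrite br0l.
have [n sq] : exists n, size q = n.+1.
  by apply: size_polyS; apply: contraNneq br_n0 => ->; rewrite br0r.
exists m, n; split=> //.
(* If the top coefficient cancels, then $a(m+n)=0$: either $a=0$, where symbols commute, or $m+n=0$,
   where the bracket is zero by size. *)
have [eq|ne] := eqVneq (- a * m%:Z) (a * n%:Z); last first.
  by rewrite -(size_br hK sp sq ne) br1 size_poly1.
have [a0|a0] := eqVneq a 0.
  by move: br_n0; rewrite a0 oppr0 /br /shift !addr0 !comp_polyXr mulrC subrr eqxx.
have le_mn := size_br_le a (- a) sp sq; rewrite br1 size_poly1 in le_mn.
move: eq => /eqP; rewrite mulNr -mulrN -subr_eq0 -mulrBr mulf_eq0 (negPf a0) /=; lia.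
Qed.

(** Commuting symbols of equal nonzero degree [a] have equal polynomial degree. Subtracting from [q]
    the multiple of [p] with the same leading coefficient leaves a commuting symbol of smaller
    degree, hence 0. *)
Lemma br_self_eq0 a p q : a != 0 -> p != 0 -> br a p a q = 0 ->
  exists k, q = k *: p.
Proof.
move=> a0 p0 br0; have [->|q0] := eqVneq q 0; first by exists 0; rewrite scale0r.
have [m sp] := size_polyS p0; have [n sq] := size_polyS q0.
have nm : n = m by have := br_eq0_size sp sq br0; move/(mulfI a0); lia.
exists (lead_coef q / lead_coef p); apply/eqP; rewrite -subr_eq0; apply/negPn/negP => r0.
have [l sr] := size_polyS r0.
have brr : br a p a (q - lead_coef q / lead_coef p *: p) = 0.
  by rewrite brBr brZr br_id br0 scaler0 subr0.
have lm : l = m by have := br_eq0_size sp sr brr; move/(mulfI a0); lia.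
have := lead_coef_eq0 (q - lead_coef q / lead_coef p *: p); rewrite (negPf r0).
rewrite [lead_coef (_ - _)]/lead_coef sr lm /= coefB coefZ => /negP; apply.
have -> : p`_m = lead_coef p by rewrite /lead_coef sp.
have -> : q`_m = lead_coef q by rewrite /lead_coef sq nm.
by rewrite divfK ?lead_coef_eq0 // subrr.
Qed.

Lemma symbol_polyC e (f : {poly K}) :
  symbol e f%:P = (if 0 <= e then f`_(absz e) else 0)%:P.
Proof.
rewrite (symbolE e (size_polyC_leq1 _)) big_ord1 /diag coefC add0r.
by rewrite /fallfact big_ord0 alg_polyC.
Qed.

Lemma exp_wX n : X ^+ n = ('X^n : {poly K})%:P.
Proof.
elim: n => [|n IH]; first by rewrite !expr0.
by rewrite !exprS IH [LHS]actC -mul_polyC polyCM.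
Qed.

Lemma exp_wY n : Y ^+ n = ('X^n : {poly {poly K}}).
Proof. by elim: n => [|n IH]; rewrite ?expr0 // !exprSr mulr_wY IH. Qed.

Lemma symbol_exp_wX e n : symbol e (X ^+ n) = (e == n%:Z)%:R%:P.
Proof.
rewrite exp_wX symbol_polyC coefXn; congr _%:P.
have -> : (e == n%:Z) = (0 <= e) && (absz e == n) by lia.
by case: (0 <= e).
Qed.

Lemma symbol_exp_wY e n : symbol e (Y ^+ n) = if e == - n%:Z then fallfact K n else 0.
Proof.
have sz : (size ('X^n : {poly {poly K}}) <= n.+1)%N by rewrite size_polyXn.
rewrite exp_wY (symbolE _ sz) big_ord_recr /= big1 => [|i _].
  rewrite add0r /diag coefXn eqxx coef1; have [->|ne] := eqVneq e (- n%:Z).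
    by rewrite subrr /= scale1r.
  case: ifP => ge0; last by rewrite scale0r.
  have -> : (absz (n%:Z + e) == 0%N) = false by lia.
  by rewrite scale0r.
by rewrite /diag coefXn ltn_eqF // coef0 if_same scale0r.
Qed.

Lemma symbol_wX e : symbol e X = (e == 1)%:R%:P.
Proof. exact: (symbol_exp_wX e 1). Qed.

Lemma symbol_wY e : symbol e Y = if e == -1 then fallfact K 1 else 0.
Proof. exact: (symbol_exp_wY e 1). Qed.

Lemma symbol1 e : symbol e (1 : weylA K) = (e == 0)%:R%:P.
Proof. by rewrite -(expr0 X) symbol_exp_wX. Qed.

End CommutingSymbols.

(** * Homogeneous parts of the relation and shape of the components *)

Section Components.
Variable K : fieldType.
Hypothesis hK : [pchar K] =i pred0.
Local Notation X := (wX K : weylA K).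
Local Notation Y := (wY K : weylA K).
Implicit Types (P Q : weylA K) (a b c d e : int) (p q : {poly K}).

Lemma supported_sym a b P : supported a b P -> supported b a P.
Proof. by move=> sup e eb ea; apply: sup. Qed.

Lemma supportedN a b P : supported a b P -> supported a b (- P).
Proof.
by move=> sup e ea eb; rewrite -scaleN1r symbolZ sup // scaler0.
Qed.

Lemma commutator_component a b c d P Q e : a != b -> c != d ->
  supported a b P -> supported c d Q -> P * Q = Q * P + 1 ->
  shift c (symbol (e - c) P) * symbol c Q + shift d (symbol (e - d) P) * symbol d Q
  - (shift a (symbol (e - a) Q) * symbol a P + shift b (symbol (e - b) Q) * symbol b P)
  = (e == 0)%:R%:P.
Proof.
move=> ab cd supP supQ PQ; rewrite -symbol1.
rewrite -(symbol_mul hK e P cd supQ) -(symbol_mul hK e Q ab supP) PQ symbolD.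
by rewrite addrC addKr.
Qed.

(** No other pair of components reaches degree $a+c$, so this bracket alone must give the part of 1
    in that degree. *)
Lemma br_single a b c d P Q : a != b -> c != d -> a + c != b + d ->
  supported a b P -> supported c d Q -> P * Q = Q * P + 1 ->
  br a (symbol a P) c (symbol c Q) = (a + c == 0)%:R%:P.
Proof.
move=> ab cd ne supP supQ PQ.
rewrite -(commutator_component (a + c) ab cd supP supQ PQ) addrK.
rewrite (supP (a + c - d)); [|lia|lia].
rewrite (supQ (a + c - b)); [|lia|lia].
by rewrite [a + c - a]addrC addKr /br /shift !comp_poly0 !mul0r !addr0.
Qed.

Lemma br_double a b c d P Q : a != b -> c != d -> a + c = b + d ->
  supported a b P -> supported c d Q -> P * Q = Q * P + 1 ->
  br a (symbol a P) c (symbol c Q) + br b (symbol b P) d (symbol d Q)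
  = (a + c == 0)%:R%:P.
Proof.
move=> ab cd eq supP supQ PQ.
rewrite -(commutator_component (a + c) ab cd supP supQ PQ) addrK.
have -> : a + c - d = b by rewrite eq addrK.
have -> : a + c - b = d by rewrite eq addrC addKr.
rewrite [a + c - a]addrC addKr /br.
by rewrite opprD addrACA.
Qed.

(** The polynomial degrees $m$, $n$ satisfy $m+n=1$, while [size_symbol_ge] gives $-m \le a \le n$;
    and $a \ne 0$ because symbols of degree 0 commute. *)
Lemma br_eq1_degree a P Q :
  br a (symbol a P) (- a) (symbol (- a) Q) = 1 ->
  a = 1 /\ size (symbol a P) = 1%N /\ size (symbol (- a) Q) = 2%N \/
  a = -1 /\ size (symbol a P) = 2%N /\ size (symbol (- a) Q) = 1%N.
Proof.
move=> br1; have [m [n [sp sq mn]]] := br_eq1_size hK br1.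
have gem := size_symbol_ge sp; have gen := size_symbol_ge sq.
have a0 : a != 0.
  apply/eqP => a0; have := oner_neq0 {poly K}.
  by rewrite -br1 a0 oppr0 /br /shift !addr0 !comp_polyXr mulrC subrr eqxx.
have [[a1 [m0 n0]]|[a1 [m0 n0]]] :
  a = 1 /\ m = 0%N /\ n = 1%N \/ a = -1 /\ m = 1%N /\ n = 0%N by lia.
  by left; rewrite sp sq m0 n0.
by right; rewrite sp sq m0 n0.
Qed.

Lemma size_scale_fallfact1 P : (size (symbol (-1) P) <= 2)%N ->
  exists m, symbol (-1) P = m *: fallfact K 1.
Proof. by apply: symbol_extremal. Qed.

Lemma br_const_fallfact1 (l m : K) :
  br 1 l%:P (-1) (m *: fallfact K 1) = (- (l * m))%:P.
Proof.
rewrite /br /shift comp_polyC comp_polyZ /fallfact big_ord1 subr0 comp_polyX -!mul_polyC.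
by rewrite polyCN polyCM; ring.
Qed.

(** [fallfact K 1] is the symbol of $Y$. Commuting with it forces $b=-i$ for $i$ the degree of the
    symbol, the extremal case, so the component is a multiple of $Y^i$. *)
Lemma lowering_form b P : b != 1 -> supported 1 b P -> (size (symbol 1 P) <= 1)%N ->
  br b (symbol b P) (-1) (fallfact K 1) = 0 ->
  exists l r i, [/\ symbol 1 P = l%:P, P = l *: X + r *: Y ^+ i
    & (r == 0) && (i == 0)%N || (b == - i%:Z) && (size (symbol b P) == i.+1)].
Proof.
move=> b1 sup /size1_polyC s1 br0.
have s1E : exists l, symbol 1 P = l%:P by exists (symbol 1 P)`_0.
case: s1E => l s1E; exists l.
have [pb0|/size_polyS[i sp]] := eqVneq (symbol b P) 0.
  exists 0, 0%N; split; rewrite ?eqxx //; apply: symbol_inj => e.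
  rewrite scale0r addr0 symbolZ symbol_wX.
  have [->|e1] := eqVneq e 1; first by rewrite s1E alg_polyC.
  have [->|eb] := eqVneq e b; last by rewrite sup // scaler0.
  by rewrite pb0 scaler0.
have bi : i%:Z + b = 0.
  have := br_eq0_size hK sp (size_fallfact K 1) br0; lia.
have [|r rE] := symbol_extremal (a := P) bi; first by rewrite sp.
exists r, i; split=> //; last by rewrite sp eqxx andbT; apply/orP; right; lia.
apply: symbol_inj => e.
rewrite symbolD !symbolZ symbol_wX symbol_exp_wY.
have -> : (e == - i%:Z) = (e == b) by lia.
have [->|e1] := eqVneq e 1.
  by rewrite s1E alg_polyC eq_sym (negPf b1) scaler0 addr0.
have [->|eb] := eqVneq e b; first by rewrite scaler0 add0r rE.
by rewrite sup // !scaler0 addr0.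
Qed.

(** Dual to [lowering_form]: a symbol commuting with that of $X$ is constant, which forces $d \ge 0$
    and a multiple of $X^d$. *)
Lemma raising_form d Q : d != -1 -> supported (-1) d Q -> (size (symbol (-1) Q) <= 2)%N ->
  br 1 1 d (symbol d Q) = 0 ->
  exists m v j, [/\ symbol (-1) Q = m *: fallfact K 1, Q = m *: Y + v *: X ^+ j
    & (v == 0) && (j == 0)%N || (d == j%:Z) && (size (symbol d Q) == 1)%N].
Proof.
move=> d1 sup /size_scale_fallfact1[m mE] br0; exists m.
have [qd0|/size_polyS[n sq]] := eqVneq (symbol d Q) 0.
  exists 0, 0%N; split; rewrite ?eqxx //; apply: symbol_inj => e.
  rewrite scale0r addr0 symbolZ symbol_wY.
  have [->|e1] := eqVneq e (-1); first by rewrite mE.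
  have [->|ed] := eqVneq e d; last by rewrite sup // scaler0.
  by rewrite qd0 scaler0.
have n0 : n = 0%N.
  have := br_eq0_size hK (size_poly1 K) sq br0; lia.
have ged := size_symbol_ge sq; rewrite n0 add0r in ged.
have [v vE] : exists v, symbol d Q = v%:P.
  by exists (symbol d Q)`_0; apply: size1_polyC; rewrite sq n0.
exists v, (absz d); split=> //; last first.
  by rewrite gez0_abs // eqxx sq n0 orbT.
apply: symbol_inj => e.
rewrite symbolD !symbolZ symbol_exp_wX symbol_wY gez0_abs //.
have [->|e1] := eqVneq e (-1).
  by rewrite mE eq_sym (negPf d1) scaler0 addr0.
have [->|ed] := eqVneq e d; first by rewrite scaler0 add0r vE alg_polyC.
by rewrite sup // !scaler0 addr0.
Qed.

End Components.

(** * One opposite pair of degrees *)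

Section LonePair.
Variable K : fieldType.
Hypothesis hK : [pchar K] =i pred0.
Local Notation X := (wX K : weylA K).
Local Notation Y := (wY K : weylA K).
Implicit Types (P Q : weylA K) (a b c d e : int) (p q : {poly K}).

Lemma brZl a p b q (k : K) : br a (k *: p) b q = k *: br a p b q.
Proof. by rewrite br_antisym brZr -scalerN -br_antisym. Qed.

Lemma size2_neq0 (m : K) : size (m *: fallfact K 1) = 2%N -> m != 0.
Proof. by move=> s2; apply/eqP => m0; move: s2; rewrite m0 scale0r size_poly0. Qed.

Lemma swap_commutator P Q : P * Q = Q * P + 1 -> Q * - P = - P * Q + 1.
Proof. by move=> PQ; rewrite mulrN mulNr PQ opprD addrNK. Qed.

Lemma br_swap a P b Q :
  br b (symbol b Q) a (symbol a (- P)) = br a (symbol a P) b (symbol b Q).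
Proof. by rewrite -scaleN1r symbolZ brZr scaleN1r -br_antisym. Qed.

Lemma tame_of_br_deg1 b d P Q : b != 1 -> d != -1 ->
  supported 1 b P -> supported (-1) d Q ->
  br 1 (symbol 1 P) (-1) (symbol (-1) Q) = 1 ->
  br 1 (symbol 1 P) d (symbol d Q) = 0 ->
  br b (symbol b P) (-1) (symbol (-1) Q) = 0 ->
  br b (symbol b P) d (symbol d Q) = 0 -> tame P Q.
Proof.
move=> b1 d1 supP supQ br1 br1d brb1 brbd.
have [[_ [s1 s2]]|[]//] := br_eq1_degree hK br1.
have [m mE] : exists m, symbol (-1) Q = m *: fallfact K 1.
  by apply: size_scale_fallfact1; rewrite s2.
have m0 : m != 0 by apply: size2_neq0; rewrite -mE.
have [l lE] : exists l, symbol 1 P = l%:P.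
  by exists (symbol 1 P)`_0; apply: size1_polyC; rewrite s1.
have l0 : l != 0 by apply: contra_eqN s1 => /eqP l0; rewrite lE l0 size_poly0.
have brb_ff : br b (symbol b P) (-1) (fallfact K 1) = 0.
  by apply/eqP; move/eqP: brb1; rewrite mE brZr scaler_eq0 (negPf m0).
have br1d_1 : br 1 1 d (symbol d Q) = 0.
  by apply/eqP; move/eqP: br1d; rewrite lE -alg_polyC brZl scaler_eq0 (negPf l0).
have [|l' [r [i [lE' PE ri]]]] := lowering_form hK b1 supP _ brb_ff; first by rewrite s1.
have [|m' [v [j [mE' QE vj]]]] := raising_form hK d1 supQ _ br1d_1; first by rewrite s2.
have lm : - (l' * m') = 1.
  by apply: polyC_inj; rewrite -br_const_fallfact1 -lE' -mE' br1.
rewrite PE QE; apply: tame_shears => //.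
case/orP: ri => [/andP[_ ->] //|/andP[/eqP bi /eqP sp]].
case/orP: vj => [/andP[_ ->] //|/andP[/eqP dj /eqP sq]]; first by rewrite orbT.
(* Nonzero multiples of $Y^i$ and $X^j$ commute only if $ij=0$. *)
have := br_eq0_size hK sp sq brbd; rewrite bi dj mulr0 => /eqP.
by rewrite mulf_eq0 => /orP[] /eqP[->]; rewrite ?orbT.
Qed.

Lemma tame_of_br a b d P Q : a != b -> - a != d ->
  supported a b P -> supported (- a) d Q -> P * Q = Q * P + 1 ->
  br a (symbol a P) (- a) (symbol (- a) Q) = 1 ->
  br a (symbol a P) d (symbol d Q) = 0 ->
  br b (symbol b P) (- a) (symbol (- a) Q) = 0 ->
  br b (symbol b P) d (symbol d Q) = 0 -> tame P Q.
Proof.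
move=> ab ad supP supQ PQ br1 brad brba brbd.
have [[a1 _]|[a1 _]] := br_eq1_degree hK br1; subst a.
  by apply: (tame_of_br_deg1 (b := b) (d := d)) => //; rewrite eq_sym.
rewrite opprK in ad supQ br1 brba; apply: tame_swap.
apply: (tame_of_br_deg1 (b := d) (d := b)); rewrite ?br_swap //; try by rewrite eq_sym.
exact: supportedN.
Qed.

(** Let $r$, $s$ be the degrees of the symbols of [P] and [Q], so $(b-2)r=bs$, $r \ge -b$ and $s \ge
    2-b$. Cancellation of the two brackets gives $s \le r+1$, with equality unless $b=-r$. If
    $b=-r$, then $s \ge r+2$, absurd; if $s=r+1$, then $b=-2r$, so $r=b=0$, again $b=-r$. *)
Lemma no_exotic_pair b P Q l (m : K) : l != 0 ->
  symbol b P != 0 -> symbol (b - 2) Q != 0 ->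
  br b (symbol b P) (b - 2) (symbol (b - 2) Q) = 0 ->
  br 1 l%:P (b - 2) (symbol (b - 2) Q)
    + br b (symbol b P) (-1) (m *: fallfact K 1) = 0 ->
  m != 0 -> False.
Proof.
move=> l0 /size_polyS[r sp] /size_polyS[s sq] brpq br_sum m0.
have sl : size (l%:P : {poly K}) = 1%N by rewrite size_polyC l0.
have sm : size (m *: fallfact K 1) = 2%N by rewrite size_scale // size_fallfact.
have ger := size_symbol_ge sp; have ges := size_symbol_ge sq.
have eq1 := br_eq0_size hK sp sq brpq.
have le2 := size_br_le b (-1) sp sm.
have size_eq : size (br 1 l%:P (b - 2) (symbol (b - 2) Q)) =
               size (br b (symbol b P) (-1) (m *: fallfact K 1)).
  by move/eqP: br_sum; rewrite addr_eq0 => /eqP ->; rewrite size_polyN.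
have size1 : size (br 1 l%:P (b - 2) (symbol (b - 2) Q)) = s.
  have [s0|s0] := eqVneq s 0%N; last first.
    by rewrite (size_br hK sl sq) //; lia.
  have := size_br_le 1 (b - 2) sl sq; lia.
rewrite size1 in size_eq; rewrite -size_eq in le2.
have [rb|rb] := eqVneq (- 1 * r%:Z) (b * 1%:Z).
  have {rb} br : b = - r%:Z by lia.
  subst b; nia.
have := size_br hK sp sm rb; rewrite -size_eq => s_eq; subst s.
nia.
Qed.

Lemma tame_lone_deg1 b d P Q : b != 1 -> d != -1 -> b + d != 0 ->
  supported 1 b P -> supported (-1) d Q -> P * Q = Q * P + 1 -> tame P Q.
Proof.
move=> b1 d1 bd supP supQ PQ.
have b1' : 1 != b by rewrite eq_sym.
have d1' : -1 != d by rewrite eq_sym.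
have br1 : br 1 (symbol 1 P) (-1) (symbol (-1) Q) = 1.
  by rewrite (br_single hK b1' d1' _ supP supQ PQ) // subrr eq_sym.
have brbd : br b (symbol b P) d (symbol d Q) = 0.
  rewrite (br_single hK b1 d1 _ (supported_sym supP) (supported_sym supQ) PQ) //.
  by rewrite (negPf bd).
(* The mixed brackets lie in degrees $1+d$ and $b-1$; unless these coincide, each vanishes by
   itself. *)
have [db|db] := eqVneq (1 + d) (b - 1); last first.
  apply: (tame_of_br_deg1 (b := b) (d := d)) => //.
    rewrite (br_single hK b1' d1 _ supP (supported_sym supQ) PQ) //.
    by rewrite (_ : (1 + d == 0) = false) //; lia.
  rewrite (br_single hK b1 d1' _ (supported_sym supP) supQ PQ); last by rewrite eq_sym.
  by rewrite (_ : (b - 1 == 0) = false) //; lia.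
have sum0 := br_double hK b1' d1 db supP (supported_sym supQ) PQ.
rewrite (_ : (1 + d == 0) = false) in sum0; last by lia.
have [pb0|pb0] := eqVneq (symbol b P) 0.
  apply: (tame_of_br_deg1 (b := b) (d := d)); rewrite ?pb0 ?br0l //.
  by move: sum0; rewrite pb0 br0l addr0.
have [qd0|qd0] := eqVneq (symbol d Q) 0.
  apply: (tame_of_br_deg1 (b := b) (d := d)); rewrite ?qd0 ?br0r //.
  by move: sum0; rewrite qd0 br0r add0r.
have [[_ [s1 s2]]|[]//] := br_eq1_degree hK br1.
have [m mE] : exists m, symbol (-1) Q = m *: fallfact K 1.
  by apply: size_scale_fallfact1; rewrite s2.
have m0 : m != 0 by apply: size2_neq0; rewrite -mE.
have [l lE] : exists l, symbol 1 P = l%:P.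
  by exists (symbol 1 P)`_0; apply: size1_polyC; rewrite s1.
have l0 : l != 0 by apply: contra_eqN s1 => /eqP l0; rewrite lE l0 size_poly0.
have dE : d = b - 2 by lia.
subst d; exfalso; apply: (@no_exotic_pair b P Q l m) => //.
by rewrite -lE -mE sum0.
Qed.

Lemma tame_lone a b d P Q : a != b -> - a != d -> b + d != 0 ->
  supported a b P -> supported (- a) d Q -> P * Q = Q * P + 1 -> tame P Q.
Proof.
move=> ab ad bd supP supQ PQ.
have br1 : br a (symbol a P) (- a) (symbol (- a) Q) = 1.
  by rewrite (br_single hK ab ad _ supP supQ PQ) subrr // eq_sym.
have [[a1 _]|[a1 _]] := br_eq1_degree hK br1; subst a.
  by apply: (@tame_lone_deg1 b d) => //; rewrite eq_sym.
rewrite opprK in ad supQ; apply: tame_swap.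
apply: (@tame_lone_deg1 d b) => //; try by rewrite eq_sym.
- by rewrite addrC.
- exact: supportedN.
exact: swap_commutator.
Qed.

End LonePair.

(** * Two opposite pairs of degrees, and the conclusion *)

Section PairOfPairs.
Variable K : fieldType.
Hypothesis hK : [pchar K] =i pred0.
Local Notation X := (wX K : weylA K).
Local Notation Y := (wY K : weylA K).
Implicit Types (P Q : weylA K) (a b c d e : int) (p q : {poly K}).

Lemma linear_form P (l r : K) : supported 1 (-1) P ->
  symbol 1 P = l%:P -> symbol (-1) P = r *: fallfact K 1 -> P = l *: X + r *: Y.
Proof.
move=> sup lE rE; apply: symbol_inj => e; rewrite symbolD !symbolZ symbol_wX symbol_wY.
have [->|e1] := eqVneq e 1; first by rewrite lE alg_polyC scaler0 addr0.
have [->|e2] := eqVneq e (-1); first by rewrite scaler0 add0r rE.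
by rewrite sup // !scaler0 addr0.
Qed.

Lemma tame_proportional_deg1 P Q (u v : K) :
  supported 1 (-1) P -> supported 1 (-1) Q ->
  symbol 1 Q = u *: symbol 1 P -> symbol (-1) Q = v *: symbol (-1) P ->
  (v - u) *: br 1 (symbol 1 P) (-1) (symbol (-1) P) = 1 -> tame P Q.
Proof.
move=> supP supQ uE vE br1.
have vu0 : v - u != 0.
  by apply: contra_eqN br1 => /eqP ->; rewrite scale0r eq_sym oner_neq0.
(* The scalar is absorbed into the second argument, which becomes a component of $(v-u)P$. *)
have := br1; rewrite -brZr -symbolZ => /(br_eq1_degree hK)[[_ [s1 s2]]|[]//].
rewrite symbolZ size_scale // in s2.
have [r rE] : exists r, symbol (-1) P = r *: fallfact K 1.
  by apply: size_scale_fallfact1; rewrite s2.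
have [l lE] : exists l, symbol 1 P = l%:P.
  by exists (symbol 1 P)`_0; apply: size1_polyC; rewrite s1.
rewrite (linear_form supP lE rE).
rewrite (@linear_form Q (u * l) (v * r)) //; first last.
- by rewrite vE rE scalerA.
- by rewrite uE lE -mul_polyC polyCM.
apply: tame_linear; apply: polyC_inj; rewrite -[RHS]br1 lE rE br_const_fallfact1.
by rewrite -mul_polyC -polyCM; congr _%:P; ring.
Qed.

Lemma tame_proportional a P Q (u v : K) :
  supported a (- a) P -> supported a (- a) Q ->
  symbol a Q = u *: symbol a P -> symbol (- a) Q = v *: symbol (- a) P ->
  (v - u) *: br a (symbol a P) (- a) (symbol (- a) P) = 1 -> tame P Q.
Proof.
move=> supP supQ uE vE br1.
have := br1; rewrite -brZr -symbolZ => /(br_eq1_degree hK)[[a1 _]|[a1 _]]; subst a.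
  exact: (tame_proportional_deg1 supP supQ uE vE br1).
rewrite opprK in supP supQ vE br1.
apply: (tame_proportional_deg1 (supported_sym supP) (supported_sym supQ) vE uE).
by rewrite br_antisym scalerN -scaleNr opprB.
Qed.

Lemma tame_double a b P Q : a != b ->
  supported a b P -> supported (- a) (- b) Q -> P * Q = Q * P + 1 -> tame P Q.
Proof.
move=> ab supP supQ PQ.
have ba : b != a by rewrite eq_sym.
have nab : - a != - b by rewrite eqr_opp.
have nba : - b != - a by rewrite eqr_opp.
have supP' := supported_sym supP; have supQ' := supported_sym supQ.
have sum1 : br a (symbol a P) (- a) (symbol (- a) Q)
    + br b (symbol b P) (- b) (symbol (- b) Q) = 1.
  by rewrite (br_double hK ab nab _ supP supQ PQ) ?subrr.
have ab_neq : a - b != b - a by lia.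
have ba_neq : b - a != a - b by lia.
have brab : br a (symbol a P) (- b) (symbol (- b) Q) = 0.
  by rewrite (br_single hK ab nba ab_neq supP supQ' PQ) subr_eq0 (negPf ab).
have brba : br b (symbol b P) (- a) (symbol (- a) Q) = 0.
  by rewrite (br_single hK ba nab ba_neq supP' supQ PQ) subr_eq0 (negPf ba).
have [brb0|brb0] := eqVneq (br b (symbol b P) (- b) (symbol (- b) Q)) 0.
  apply: (tame_of_br hK ab nab supP supQ) => //.
  by rewrite brb0 addr0 in sum1.
have [bra0|bra0] := eqVneq (br a (symbol a P) (- a) (symbol (- a) Q)) 0.
  apply: (tame_of_br hK ba nba supP' supQ') => //.
  by rewrite bra0 add0r in sum1.
have [pa0 pb0] : symbol a P != 0 /\ symbol b P != 0.
  by split; [apply: contraNneq bra0 | apply: contraNneq brb0] => ->; rewrite br0l.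
have [qa0 qb0] : symbol (- a) Q != 0 /\ symbol (- b) Q != 0.
  by split; [apply: contraNneq bra0 | apply: contraNneq brb0] => ->; rewrite br0r.
have [ma spa] := size_polyS pa0; have [mb spb] := size_polyS pb0.
have [na sqa] := size_polyS qa0; have [nb sqb] := size_polyS qb0.
have eqab := br_eq0_size hK spa sqb brab.
have eqba := br_eq0_size hK spb sqa brba.
have mna : (0 < ma + na)%N.
  by rewrite (leq_trans _ (size_br_le a (- a) spa sqa)) // size_poly_gt0.
have mnb : (0 < mb + nb)%N.
  by rewrite (leq_trans _ (size_br_le b (- b) spb sqb)) // size_poly_gt0.
have a0 : a != 0 by apply/eqP => a0; subst a; nia.
have b0 : b != 0 by apply/eqP => b0; subst b; nia.
have sa : size (br a (symbol a P) (- a) (symbol (- a) Q)) = (ma + na)%N.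
  by apply: (size_br hK) => //; nia.
have sb : size (br b (symbol b P) (- b) (symbol (- b) Q)) = (mb + nb)%N.
  by apply: (size_br hK) => //; nia.
(* Otherwise the larger size, at least 2, would survive in a sum equal to 1. *)
have eq_mn : (ma + na = mb + nb)%N.
  case: (ltngtP (ma + na) (mb + nb)) => // lt_mn.
    have := size_poly1 K; rewrite -sum1 addrC size_polyDl ?sa ?sb //; lia.
  have := size_poly1 K; rewrite -sum1 size_polyDl ?sa ?sb //; lia.
(* Adding [eqab] and [eqba] gives $b(m_a+n_a) = -a(m_b+n_b)$, and the two positive sums are
   equal. *)
have bE : b = - a by nia.
subst b; rewrite opprK in supQ sum1 brab eqab sqb.
have [u uE] := br_self_eq0 hK a0 pa0 brab.
have na0 : - a != 0 by rewrite oppr_eq0.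
have [v vE] := br_self_eq0 hK na0 pb0 brba.
apply: (tame_proportional supP (supported_sym supQ) uE vE).
by rewrite -sum1 uE vE !brZr (br_antisym (- a)) scalerN scalerBl.
Qed.

Lemma tame_opposite a b c d P Q : a != b -> c != d -> a + c = 0 ->
  supported a b P -> supported c d Q -> P * Q = Q * P + 1 -> tame P Q.
Proof.
move=> ab cd ac supP supQ PQ; have cE : c = - a by apply/eqP; rewrite -addr_eq0 addrC ac.
subst c; have [bd|bd] := eqVneq (b + d) 0; last first.
  exact: (tame_lone hK ab cd bd supP supQ PQ).
have dE : d = - b by apply/eqP; rewrite -addr_eq0 addrC bd.
by subst d; apply: (tame_double ab supP supQ PQ).
Qed.

Lemma tame_of_mass P Q : (wmass P <= 2)%N -> (wmass Q <= 2)%N ->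
  P * Q = Q * P + 1 -> tame P Q.
Proof.
move=> /mass_supported[a [b [ab supP]]] /mass_supported[c [d [cd supQ]]] PQ.
have ba : b != a by rewrite eq_sym.
have dc : d != c by rewrite eq_sym.
have supP' := supported_sym supP; have supQ' := supported_sym supQ.
have [ac|ac] := eqVneq (a + c) 0; first exact: (tame_opposite ab cd ac).
have [ad|ad] := eqVneq (a + d) 0; first exact: (tame_opposite ab dc ad).
have [bc|bc] := eqVneq (b + c) 0; first exact: (tame_opposite ba cd bc).
have [bd|bd] := eqVneq (b + d) 0; first exact: (tame_opposite ba dc bd).
(* If no sum of degrees vanishes, the degree-zero part of the commutator is 0 instead of 1. *)
have := commutator_component hK 0 ab cd supP supQ PQ.
rewrite !sub0r.
have -> : symbol (- c) P = 0 by apply: supP; lia.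
have -> : symbol (- d) P = 0 by apply: supP; lia.
have -> : symbol (- a) Q = 0 by apply: supQ; lia.
have -> : symbol (- b) Q = 0 by apply: supQ; lia.
rewrite /shift !comp_poly0 !mul0r !addr0 subr0 eqxx => /eqP.
by rewrite eq_sym oner_eq0.
Qed.

End PairOfPairs.

Theorem theorem1p1 (K : fieldType) (hK : [pchar K] =i pred0)
  (P Q : weyl K) :
  (wmass P <= 2)%N -> (wmass Q <= 2)%N ->
  wmul P Q - wmul Q P = w1 K ->
  exists tau : weyl K -> weyl K,
    [/\ weyl_aut tau, P = tau (wY K) & Q = tau (wX K)].
Proof.
move=> massP massQ PQ; apply: (tame_of_mass hK massP massQ).
by move/eqP: PQ; rewrite subr_eq addrC !wmul_weylA => /eqP.
Qed.
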